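(* Let $G$ be a finite soluble group such that every maximal subgroup $M$ of $G$ with $\pi(M)=\pi(G)$ is nilpotent. Then the quotient group $G/Z_\infty(G)$ is quasi-$k$-primary, where $k=|\pi(G/Z_\infty(G))|-1$.
   Context: All groups are finite. For a group $X$, $\pi(X)$ denotes the set of all prime divisors of $|X|$. For an integer $k$, a group $X$ is called quasi-$k$-primary if $|\pi(X)|>k$ and $|\pi(Y)|\le k$ for every maximal subgroup $Y$ of $X$ (so the trivial group, having no maximal subgroups, is quasi-$(-1)$-primary). The hypercenter of $G$ is $Z_\infty(G)=\bigcup_{i\ge 0}Z_i(G)$, where $Z_0(G)=1$ and $Z_i(G)/Z_{i-1}(G)=Z(G/Z_{i-1}(G))$ for $i\ge 1$. *)

(* Defs.v *)
From HB Require Import structures.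
From mathcomp Require Import all_boot all_order all_algebra.
From mathcomp Require Import all_fingroup all_solvable.

Set Implicit Arguments.
Unset Strict Implicit.
Unset Printing Implicit Defensive.

Import GroupScope.

(* #|G| is only a cutoff: 'Z_i(G) is constant for i >= #|G|, so this is the   *)
(* union over all i : nat; see hypercenterP.                                  *)
Definition hypercenter (gT : finGroupType) (G : {set gT}) : {set gT} :=
  \bigcup_(i < #|G|.+1) 'Z_i(G).

Section Hypercenter.

Variables (gT : finGroupType) (G : {group gT}).

Lemma ucn_stable n m : 'Z_n.+1(G) = 'Z_n(G) -> n <= m -> 'Z_m(G) = 'Z_n(G).
Proof.
move=> eqZ /subnKC <-; elim: (m - n) => [|d IHd]; first by rewrite addn0.
by rewrite addnS -[RHS]eqZ !ucnSn IHd.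
Qed.

Lemma ucn_card_cutoff m : #|G| <= m -> 'Z_m(G) = 'Z_#|G|(G).
Proof.
move=> leGm; have [n [leGn eqZ]]: exists n, n <= #|G| /\ 'Z_n.+1(G) = 'Z_n(G).
  suff: forall k, (exists n, n <= k /\ 'Z_n.+1(G) = 'Z_n(G)) \/ k < #|'Z_k(G)|.
    move/(_ #|G|)=> [//|]; rewrite ltnNge subset_leq_card //.
    exact: ucn_sub.
  elim=> [|k [[n [len eqZ]]|ltk]]; first by right; rewrite ucn0 cards1.
    by left; exists n; split; first exact: leqW.
  have [eqZ|neZ] := eqVneq 'Z_k.+1(G) 'Z_k(G).
    by left; exists k; split.
  right; apply: leq_ltn_trans ltk _; apply: proper_card.
  by rewrite properEneq eq_sym neZ ucn_subS.
by rewrite (ucn_stable eqZ leGn) (ucn_stable eqZ (leq_trans leGn leGm)).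
Qed.

Lemma hypercenterP x : reflect (exists i, x \in 'Z_i(G)) (x \in hypercenter G).
Proof.
apply: (iffP bigcupP) => [[i _ Zx]|[i Zx]]; first by exists i.
have [lti|lei] := ltnP i #|G|.+1; first by exists (Ordinal lti).
exists ord_max => //=; rewrite -(ucn_card_cutoff (ltnW lei)); exact: Zx.
Qed.

Lemma hypercenterE : hypercenter G = 'Z_#|G|(G).
Proof.
apply/eqP; rewrite eqEsubset; apply/andP; split.
  apply/bigcupsP => i _; apply: ucn_sub_geq; by rewrite -ltnS ltn_ord.
exact: (bigcup_sup (ord_max : 'I_#|G|.+1)).
Qed.

Lemma hypercenter_group_set : group_set (hypercenter G).
Proof. by rewrite hypercenterE groupP. Qed.

Canonical hypercenter_group := Group hypercenter_group_set.

End Hypercenter.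

Definition card_pi (gT : finGroupType) (X : {set gT}) : nat :=
  size (primes #|X|).

(* k ranges over int: the trivial group is quasi-(-1)-primary. *)
Definition quasi_primary (k : int) (gT : finGroupType) (X : {group gT}) : Prop :=
  (k < (card_pi X)%:Z)%R /\
  forall Y : {group gT}, maximal Y X -> ((card_pi Y)%:Z <= k)%R.

(* Main.v *)
(** The hypothesis passes to G / Z_oo(G), which has trivial centre, so it
    suffices to see that a soluble group G with a nilpotent maximal subgroup M
    such that pi(M) = pi(G) has a nontrivial centre. The index |G : M| is a
    power of a prime p, and H = O_p(M) is nontrivial. As normalizers grow in a
    Sylow p-subgroup P of G containing H, the normalizer of H is not contained
    in M, so H is normal in G. Then the intersection of H with Z(P) is
    nontrivial, and it is centralized both by P and by M = H x O_p'(M), hence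
    by G = MP. *)

Require Import Defs.
From mathcomp Require Import all_boot all_order all_algebra.
From mathcomp Require Import all_fingroup all_solvable.

Import GRing.Theory Num.Theory.

Import GroupScope.

(** [K] need not lie in [G], so it can be a full normalizer: [G :&: K] contains both [M] and [H],
    hence cannot be proper in [G]. *)
Lemma maximal_subG {gT : finGroupType} {G M H K : {group gT}} :
    maximal M G -> H \subset G -> ~~ (H \subset M) ->
  M \subset K -> H \subset K -> G \subset K.
Proof.
move=> /maxgroupP[/proper_sub sMG maxM] sHG not_sHM sMK sHK.
apply: contraR not_sHM => not_sGK.
rewrite -(maxM (G :&: K)%G) /= ?subsetI ?sMG ?sHG //.
by rewrite properE subsetIl subsetI subxx.
Qed.

(** By solubility, a chief factor [U / V] with [V] inside [M] but [U] not is elementary abelian; as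
    [M * U = G], the index of [M] divides [#|U : V|]. *)
Lemma sol_maximal_index {gT : finGroupType} {G M : {group gT}} :
  solvable G -> maximal M G ->
  exists2 p : nat, p \in \pi(#|G : M|) & p.-nat #|G : M|.
Proof.
move=> solG maxM; have [/andP[sMG not_sGM] _] := maxgroupP maxM.
have [|U /mingroupP[/andP[nsUG not_sUM] minU] _] :=
    @mingroup_exists _ (fun U : {group gT} => (U <| G) && ~~ (U \subset M)) G.
  by rewrite normal_refl.
have [|V maxV _] := @maxgroup_exists _
    (fun V : {group gT} => (V \proper U) && (G \subset 'N(V))) 1%G.
  rewrite norms1 andbT proper1G.
  by apply: contraNneq not_sUM => ->; rewrite sub1G.
have [/andP[ltVU nVG] _] := maxgroupP maxV; have sVU := proper_sub ltVU.
have [sUG nUG] := andP nsUG.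
(* Otherwise the minimality of [U] would force [V = U]. *)
have sVM : V \subset M.
  move: ltVU; apply: contraLR => not_sVM; rewrite (minU V) ?properxx //.
  by rewrite /normal nVG not_sVM (subset_trans sVU sUG).
have chiefUV : chief_factor G V U by rewrite /chief_factor /maxnormal maxV nsUG.
have [_ _ /is_abelemP[p _ abUV]] :=
  minnormal_solvable (chief_factor_minnormal chiefUV) (subxx _)
    (quotient_sol V (solvableS sUG solG)).
suff pGM : p.-nat #|G : M|.
  have pi_q : pdiv #|G : M| \in \pi(#|G : M|) by rewrite pi_pdiv indexg_gt1.
  have := pnatPpi pGM pi_q; rewrite inE => /eqP def_p.
  by exists p; first rewrite -{1}def_p.
have defG : M * U = G.
  rewrite -norm_joinEl ?(subset_trans sMG) //; apply/eqP.
  rewrite eqEsubset join_subG sMG sUG.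
  by apply: maximal_subG maxM sUG not_sUM _ _; rewrite ?joing_subl ?joing_subr.
have -> : #|G : M| = #|U : M| by rewrite -defG indexMg.
apply: (@pnat_dvd _ #|U : V|).
  by rewrite -(indexgI U M) indexgS // subsetI sVU.
rewrite -card_quotient ?(subset_trans sUG) //.
exact: abelem_pgroup abUV.
Qed.

Lemma nil_maximal_center_neq1 {gT : finGroupType} {p : nat}
    {G M : {group gT}} :
    maximal M G -> nilpotent M -> p.-nat #|G : M| -> p \in \pi(M) ->
  'Z(G) != 1.
Proof.
move=> maxM nilM pGM piMp; have [/andP[sMG not_sGM] _] := maxgroupP maxM.
have sylH : p.-Sylow(M) 'O_p(M) := nilpotent_pcore_Hall p nilM.
have sHM : 'O_p(M) \subset M := pcore_sub p M.
have ntH : 'O_p(M) != 1.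
  by rewrite -cardG_gt1 (card_Hall sylH) p_part_gt1.
have [P sylP sHP] := Sylow_superset (subset_trans sHM sMG) (pcore_pgroup p M).
have pP := pHall_pgroup sylP; have sPG := pHall_sub sylP.
have defG : M * P = G.
  apply: coprime_index_mulG => //; apply: pnat_coprime pGM _.
  by have /and3P[] := sylP.
have not_sPM : ~~ (P \subset M).
  by apply: contra not_sGM => sPM; rewrite -defG mul_subG.
have ltHP : 'O_p(M) \proper P.
  by rewrite properE sHP; apply: contra not_sPM => /subset_trans->.
have nHG : G \subset 'N('O_p(M)).
  apply: maximal_subG maxM _ _ (gFnorm _ _) (subsetIr P _).
    exact: subIset (introT orP (or_introl sPG)).
  (* If the normalizer of ['O_p(M)] in [P] lay in [M], this [p]-group would lie in the normal Sylow
     subgroup ['O_p(M)] of [M]. *)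
  have := nilpotent_proper_norm (pgroup_nil pP) ltHP.
  rewrite properE subsetI sHP normG /=; apply: contra => sNM.
  by rewrite (sub_normal_Hall sylH) ?pcore_normal // (pgroupS (subsetIl P _)).
have nsHP : 'O_p(M) <| P by rewrite /normal sHP (subset_trans sPG).
have := meet_center_nil (pgroup_nil pP) nsHP ntH.
apply: contraNneq => ZG1; rewrite -subG1 -ZG1 subsetI.
rewrite (subset_trans (subsetIl _ _) (subset_trans sHM sMG)) /=.
have cZP : P \subset 'C('O_p(M) :&: 'Z(P)).
  by rewrite centsC (subset_trans (subsetIr _ _)) ?subsetIr.
rewrite centsC -defG mul_subG //.
have /dprodP[_ defM cHK _] := nilpotent_pcoreC p nilM.
rewrite -{1}defM mul_subG ?(subset_trans sHP) //.
by rewrite (subset_trans cHK) // centS ?subsetIl.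
Qed.

(** The upper central series is constant from index [#|G|] on, so one more step adds nothing. *)
Lemma center_quotient_hypercenter {gT : finGroupType} (G : {group gT}) :
  'Z(G / hypercenter G) = 1.
Proof.
by rewrite hypercenterE -ucn_central ucn_card_cutoff ?leqnSn // trivg_quotient.
Qed.

Theorem theorem2 (gT : finGroupType) (G : {group gT}) :
  solvable G ->
  (forall M : {group gT}, maximal M G -> \pi(M) =i \pi(G) -> nilpotent M) ->
  quasi_primary ((card_pi (G / hypercenter G)%g)%:Z - 1)%R
                (G / hypercenter G)%G.
Proof.
move=> solG nilM; set Z := hypercenter G; split=> [|Y maxY].
  by rewrite ltrBlDr ltrDl.
have nsZG : Z <| G by rewrite /Z hypercenterE ucn_normal.
have sYG : Y \subset G / Z by have [/proper_sub] := maxgroupP maxY.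
have sub_pi : {subset primes #|Y| <= primes #|G / Z|}.
  exact: piSg.
(* If the bound failed, [Y] would have as many prime divisors as [G / Z], hence the same ones. *)
rewrite -ltzD1 subrK ltz_nat ltnNge; apply/negP=> le_pi.
have eq_pi := uniq_min_size (primes_uniq _) sub_pi le_pi.
have [M defY sZM sMG] := inv_quotientS nsZG sYG.
have nsZM : Z <| M := normalS sZM sMG nsZG.
have maxM : maximal M G by rewrite -(quotient_maximal nsZM) -?defY.
have {}nilM : nilpotent M.
  (* The primes of [M] and of [G] are those of [Z] together with those of [Y] and of [G / Z],
     respectively. *)
  apply: nilM maxM _ => q /=; rewrite -(Lagrange (normal_sub nsZM)).
  rewrite -(Lagrange (normal_sub nsZG)) !primesM ?cardG_gt0 ?indexg_gt0 //.
  by rewrite -!card_quotient ?normal_norm // -defY eq_pi.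
have nilY : nilpotent Y by rewrite defY quotient_nil.
have [p piGYp pGY] := sol_maximal_index (quotient_sol _ solG) maxY.
have: 'Z(G / Z) != 1.
  apply: nil_maximal_center_neq1 maxY nilY pGY _.
  by rewrite [_ \in _]eq_pi (pi_of_dvd (dvdn_indexg _ _) _ piGYp).
by rewrite center_quotient_hypercenter eqxx.
Qed.
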